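(* Let $n\geq 1$ and let $w,w'\in \mathcal{W}_{2n}^R$ be reduced $\mathfrak{sl}_2$ webs. Then $w\prec_S w'$ if and only if $w\prec_T w'$. In other words, the partial orders $\prec_T$ and $\prec_S$ coincide on the set $\mathcal{W}_{2n}^R$.
   Context: $\mathcal{W}_{2n}^R$ is the set of reduced $\mathfrak{sl}_2$ bottom webs on $2n$ points: crossingless matchings of the boundary points $1,2,\dots,2n$ on the $x$-axis by arcs in the upper half-plane (no closed circle components), up to isotopy. Faces of $w$ are the connected components of the complement of $w$ in the upper half-plane, and the depth of a face is the minimum number of arcs of $w$ that a path from it to the unbounded face must cross. The boundary word of $w$ has $i$-th symbol $+$ if the depth immediately to the left of $i$ is smaller than to the right (i.e. $i$ is the left endpoint of its arc) and $-$ if it is larger (i.e. $i$ is a right endpoint). The bijection $\psi:\mathcal{W}_{2n}^R\to SYT(n,n)$ (standard Young tableaux of shape $(n,n)$) puts $i$ in the top (respectively bottom) row of $\psi(w)$ if the $i$-th symbol is $+$ (respectively $-$). Tableau order $\prec_T$: for standard tableaux $T,T'$ of the same shape, write $T\stackrel{s_i}{\rightarrow}T'$ if $T'$ is obtained from $T$ by swapping the entries $i$ and $i+1$, and $i$ is in a row above $i+1$ in $T'$. Write $T\prec T'$ if there is a chain of one or more such arrows from $T$ to $T'$. Then $w\prec_T w'$ means $\psi(w)\prec\psi(w')$. Shadow containment order $\prec_S$: for $d\ge 0$ the $d$-band of $w$ is the closure of the union of all faces of depth $d$. For $d\ge1$, $S_d(w)$ is the set of points on the real axis belonging to a $k$-band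 of $w$ for some $k\ge d$. For distinct webs $w,w'$, $w\prec_S w'$ means $S_d(w)\subseteq S_d(w')$ for all $d\geq 1$. *)

(* Defs.v *)
From HB Require Import structures.
From Stdlib Require Relation_Operators.
From mathcomp Require Import all_boot all_order all_algebra.
From mathcomp Require Import all_classical all_reals all_analysis.

Set Implicit Arguments.
Unset Strict Implicit.
Unset Printing Implicit Defensive.

Import Order.TTheory GRing.Theory Num.Theory.
Import numFieldNormedType.Exports.

Local Open Scope classical_set_scope.
Local Open Scope ring_scope.

(* A reduced web up to isotopy is the matching it induces on its boundary
   points.  The boundary points 1, ..., 2n are encoded by 'I_(2 * n), the
   index i standing for the point i.+1; a matching is given by the involution
   sending each point to the other endpoint of its arc. *)
Definition crossingless_matching n (m : {ffun 'I_(2 * n) -> 'I_(2 * n)}) :=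
  [forall i, (m i != i) && (m (m i) == i)] &&
  [forall i : 'I_(2 * n), forall k : 'I_(2 * n),
     ~~ [&& i < k, k < m i & m i < m k]%N].

Record web n := Web {
  partner :> {ffun 'I_(2 * n) -> 'I_(2 * n)};
  _ : crossingless_matching partner }.

HB.instance Definition _ n := [isSub for @partner n].
HB.instance Definition _ n := [Finite of web n by <:].

Section Planar.
Variables (R : realType) (n : nat).
Implicit Types (w : web n) (i : 'I_(2 * n)) (F : set (R * R)).

Definition pt i : R := i.+1%:R.

Definition half_plane : set (R * R) := [set p | 0 <= p.2].

(* Each isotopy class is drawn with semicircular arcs; these are pairwise
   disjoint by crossinglessness. *)
Definition web_arc w i : set (R * R) :=
  [set p | 0 <= p.2 /\
     (p.1 - (pt i + pt (w i)) / 2) ^+ 2 + p.2 ^+ 2 =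
     ((pt (w i) - pt i) / 2) ^+ 2].

Definition web_complement w : set (R * R) :=
  half_plane `\` \bigcup_i web_arc w i.

Definition face_at w (p : R * R) : set (R * R) :=
  connected_component (web_complement w) p.

Definition is_face w F :=
  exists2 p, web_complement w p & F = face_at w p.

Definition unbounded_face w F := is_face w F /\ ~ bounded_set F.

Definition is_path (g : R -> R * R) :=
  {within `[0, 1], continuous g} /\ {in `[0, 1], forall t, half_plane (g t)}.

(* [web_arc w i] and [web_arc w (w i)] are the same arc: it is counted at its left
   endpoint only. *)
Definition arcs_crossed w (g : R -> R * R) : nat :=
  #|[pred i : 'I_(2 * n) | (i < w i)%N &&
      `[< exists2 t, t \in `[0, 1] & web_arc w i (g t) >]]|.

Definition crossing_numbers w F : set nat :=
  [set k | exists g F0, [/\ is_path g, F (g 0), unbounded_face w F0, F0 (g 1)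
                          & arcs_crossed w g = k]].

(* The default value 0 is irrelevant: every face is joined to the unbounded
   face by some path. *)
Definition depth w F : nat :=
  xget 0%N [set k | crossing_numbers w F k /\
                    forall m, crossing_numbers w F m -> (k <= m)%N].

Definition depth_at w (x : R) : nat := depth w (face_at w (x, 0)).

Definition is_plus w i : bool :=
  `[< \forall e \near 0^'+,
        (depth_at w (pt i - e) < depth_at w (pt i + e))%N >].

Definition is_minus w i : bool :=
  `[< \forall e \near 0^'+,
        (depth_at w (pt i + e) < depth_at w (pt i - e))%N >].

Definition band w (d : nat) : set (R * R) :=
  closure (\bigcup_(F in [set F | is_face w F /\ depth w F = d]) F).

Definition shadow w (d : nat) : set R :=
  [set x | exists2 k, (d <= k)%N & band w k (x, 0)].

Definition prec_S w w' : Prop :=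
  w <> w' /\ forall d, (1 <= d)%N -> shadow w d `<=` shadow w' d.

End Planar.

(* A filling of a Young diagram is the list of its rows, from top to bottom. *)
Definition filling := seq (seq nat).

Definition is_standard (T : filling) : bool :=
  [&& sorted geq (shape T), 0%N \notin shape T,
      perm_eq (flatten T) (iota 1 (size (flatten T))),
      all (sorted ltn) T &
      [forall r : 'I_(size T).-1,
         forall c : 'I_(size (nth [::] T r.+1)),
         (nth 0 (nth [::] T r) c < nth 0 (nth [::] T r.+1) c)%N]].

Definition swap_entries (i : nat) (T : filling) : filling :=
  map (map [eta id with i |-> i.+1, i.+1 |-> i]) T.

Definition row_of (T : filling) (x : nat) : nat :=
  find (fun r : seq nat => x \in r) T.

Definition tab_arrow (i : nat) (T T' : filling) : Prop :=
  [/\ is_standard T, is_standard T', shape T = shape T',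
      T' = swap_entries i T & (row_of T' i < row_of T' i.+1)%N].

Definition tab_lt : filling -> filling -> Prop :=
  Relation_Operators.clos_trans filling
    (fun T T' => exists i, tab_arrow i T T').

Definition psi (R : realType) n (w : web n) : filling :=
  [:: [seq i.+1 | i : 'I_(2 * n) <- enum 'I_(2 * n) & is_plus R w i];
      [seq i.+1 | i : 'I_(2 * n) <- enum 'I_(2 * n) & is_minus R w i]].

Definition prec_T (R : realType) n (w w' : web n) : Prop :=
  tab_lt (psi R w) (psi R w').

(* Main.v *)
(* Both orders are the pointwise order on height functions, where [height w k]
   is the number of arcs of [w] above the open interval from [k] to [k + 1].

   The depth of the face of a point is the number of semicircles around that
   point: a vertical path crosses exactly these, and by the intermediate value
   theorem every path from the face to the unbounded one meets each of them.
   Hence the shadow [S_d] is the union of the intervals of height at least [d],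
   and the boundary word records the rises and falls of the height.

   A tableau arrow turns a factor [-+] of the word into [+-], which raises the
   height at a single place.  Conversely, if one height function lies below
   another, then at the first place where they differ the lower word has a [-];
   as both heights vanish at the end, the first [+] after it closes a valley at
   which the inequality is still strict, and turning this valley into a peak
   gives an arrow towards the upper word.  Finally a web is determined by its
   height, since the partner of a left endpoint is the first place at which the
   height returns to its former value. *)

Require Import Defs.
From Stdlib Require Import Relation_Operators.
From mathcomp Require Import all_boot all_order all_algebra.
From mathcomp Require Import all_classical all_reals all_analysis.
From mathcomp Require Import zify ring lra.

Set Implicit Arguments.
Unset Strict Implicit.
Unset Printing Implicit Defensive.

Import Order.TTheory GRing.Theory Num.Theory.
Import numFieldNormedType.Exports.

Local Open Scope classical_set_scope.
Local Open Scope ring_scope.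

(** Index [j] sits at abscissa [j.+1], so [j < k <= w j] says that the arc passes over the gap from
    [k] to [k.+1]; only left endpoints satisfy it, so each arc counts once. *)
Definition height n (w : web n) (k : nat) : nat :=
  #|[pred j : 'I_(2 * n) | (j < k <= w j)%N]|.

Lemma continuous_pair (T U V : topologicalType) (f : T -> U) (g : T -> V) t :
  {for t, continuous f} -> {for t, continuous g} ->
  {for t, continuous (fun s => (f s, g s))}.
Proof.
move=> cf cg; rewrite /continuous_at.
exact: (@cvg_pair _ _ _ (nbhs t) (nbhs (f t)) (nbhs (g t))).
Qed.

(** * Faces, depths and shadows of the semicircular drawing *)

Section Faces.
Variables (R : realType) (n : nat) (w : web n).
Implicit Types (p q : R * R) (i : 'I_(2 * n)).

(** The power of [p] with respect to the circle carrying the arc: negative inside, zero on it,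
    positive outside. *)
Definition arcfun i p : R :=
  (p.1 - (pt R i + pt R (w i)) / 2) ^+ 2 + p.2 ^+ 2
  - ((pt R (w i) - pt R i) / 2) ^+ 2.

Definition enclosing p : nat :=
  #|[pred i : 'I_(2 * n) | (i < w i)%N && (arcfun i p < 0)]|.

Lemma web_arcE i p : web_arc w i p <-> 0 <= p.2 /\ arcfun i p = 0.
Proof.
rewrite /web_arc /arcfun /=; split => -[p0 e]; split => //.
  by rewrite e subrr.
by move/eqP: e; rewrite subr_eq0 => /eqP.
Qed.

Lemma web_complementE p :
  web_complement w p <-> 0 <= p.2 /\ forall i, arcfun i p != 0.
Proof.
split=> [[p0 H]|[p0 H]]; split => //.
  by move=> i; apply/eqP => e; apply: H; exists i => //; exact/web_arcE.
by move=> [i _ /web_arcE[_ /eqP]]; apply/negP.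
Qed.

Lemma arcfun_continuous i : continuous (arcfun i).
Proof.
move=> p; rewrite /arcfun.
have c1 : {for p, continuous (fst : R * R -> R)} by exact: cvg_fst.
have c2 : {for p, continuous (snd : R * R -> R)} by exact: cvg_snd.
apply: cvgB; last exact: cvg_cst.
apply: cvgD; last by apply: cvgM.
apply: cvgM; by apply: cvgB => //; exact: cvg_cst.
Qed.

Lemma arcfun_le i p t : 0 <= p.2 -> 0 <= t -> arcfun i p <= arcfun i (p.1, p.2 + t).
Proof. by move=> p0 t0; rewrite /arcfun /=; nra. Qed.

Lemma arcfunE i p :
  arcfun i p = (p.1 - pt R i) * (p.1 - pt R (w i)) + p.2 ^+ 2.
Proof. by rewrite /arcfun; field. Qed.

Lemma arcfun_axis i (x : R) : arcfun i (x, 0) = (x - pt R i) * (x - pt R (w i)).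
Proof. by rewrite arcfunE expr0n addr0. Qed.

Lemma arcfun_lt0 i p :
  (i < w i)%N -> arcfun i p < 0 -> pt R i < p.1 < pt R (w i).
Proof.
move=> iw; have ab : pt R i < pt R (w i) by rewrite /pt ltr_nat.
rewrite arcfunE; have := sqr_ge0 p.2; set u := _ ^+ 2 => u0 neg.
by apply/andP; split; rewrite ltNge; apply/negP => h; nra.
Qed.

Lemma pt_bound i : 0 <= pt R i <= (2 * n)%:R.
Proof. by rewrite /pt ler0n ler_nat ltn_ord. Qed.

Lemma arcfun_far i p : (2 * n)%:R < p.2 -> 0 < arcfun i p.
Proof.
have := pt_bound i; have := pt_bound (w i); rewrite /arcfun.
set a := pt R i; set b := pt R (w i); set N := _%:R => bN aN pN.
have : 0 <= (p.1 - (a + b) / 2) ^+ 2 by exact: sqr_ge0.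
set u := _ ^+ 2 => u0.
have : 0 <= (N - (b - a) / 2) * (N + (b - a) / 2) by apply: mulr_ge0; lra.
have : 0 < (p.2 - N) * (p.2 + N) by apply: mulr_gt0; lra.
by rewrite !expr2; lra.
Qed.

(** The image of a face under [arcfun i] is an interval that misses 0. *)
Lemma face_sign i p q :
  web_complement w p -> face_at w p q -> (arcfun i p < 0) = (arcfun i q < 0).
Proof.
move=> cp Fq; have cF : connected (face_at w p) by exact: component_connected.
have Fp : face_at w p p by exact: connected_component_refl.
have nz r : face_at w p r -> arcfun i r != 0.
  by move=> /connected_component_sub/web_complementE[].
have itv : is_interval (arcfun i @` face_at w p).
  apply/connected_intervalP/connected_continuous_connected => //.
  exact/continuous_subspaceT/arcfun_continuous.
have key r s : face_at w p r -> face_at w p s -> arcfun i r < 0 -> arcfun i s < 0.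
  move=> Fr Fs r0; rewrite ltNge; apply/negP => s0.
  have := itv (arcfun i r) (arcfun i s); rewrite /is_interval.
  have ri : (arcfun i @` face_at w p) (arcfun i r) by exists r.
  have si : (arcfun i @` face_at w p) (arcfun i s) by exists s.
  move=> /(_ ri si 0); rewrite (ltW r0) s0 => /(_ isT)[u /nz /eqP].
  by [].
by apply/idP/idP; exact: key.
Qed.

Lemma enclosing_face p q :
  web_complement w p -> face_at w p q -> enclosing q = enclosing p.
Proof.
by move=> cp Fq; apply: eq_card => i; rewrite !inE (face_sign i cp Fq).
Qed.

(** A face with a point inside a circle stays inside it, hence is bounded. *)
Lemma unbounded_face_sign F i p : unbounded_face w F -> F p -> 0 < arcfun i p.
Proof.
move=> [[q cq ->] nb] Fp.
have cp := connected_component_sub Fp.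
have [_ /(_ i)] := (web_complementE p).1 cp; rewrite real_neqr_lt ?num_real//.
case/orP => // neg; case: nb.
rewrite /= /bounded_near; near=> M => r Fr.
have {neg} : arcfun i r < 0 by rewrite -(face_sign i cq Fr) (face_sign i cq Fp).
have [r0 _] := (web_complementE r).1 (connected_component_sub Fr).
(* The centre has abscissa between 0 and [2n] and the radius is at most [2n], so points inside have
   norm at most [4n]; the threshold leaves slack. *)
have M0 : (4 * (2 * n)%:R + 1 : R) <= M.
  by near: M; apply: nbhs_pinfty_ge; exact: num_real.
have := pt_bound i; have := pt_bound (w i).
rewrite /arcfun /= prod_normE ge_max !ler_norml.
set a := pt R i; set b := pt R (w i); set N := (2 * n)%:R in M0 * => bN aN neg.
have : `|(b - a) / 2| <= N by rewrite ler_norml; apply/andP; split; lra.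
set c := (b - a) / 2 in neg * => cN.
have c2 : c ^+ 2 <= N ^+ 2.
  by rewrite -(real_normK (num_real c)) lerXn2r ?nnegrE//; lra.
have {}neg : (r.1 - (a + b) / 2) ^+ 2 + r.2 ^+ 2 <= N ^+ 2 by lra.
have h1 : `|r.1 - (a + b) / 2| <= N.
  rewrite -(ler_pXn2r (ltn0Sn 1)) ?nnegrE // real_normK ?num_real //.
  by have := sqr_ge0 r.2; lra.
have h2 : `|r.2| <= N.
  rewrite -(ler_pXn2r (ltn0Sn 1)) ?nnegrE // real_normK ?num_real //.
  by have := sqr_ge0 (r.1 - (a + b) / 2); lra.
rewrite !ler_norml in h1 h2.
by apply/andP; split; apply/andP; split; lra.
Unshelve. all: by end_near. Qed.

Lemma arcs_crossed_ge p F0 (g : R -> R * R) :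
  web_complement w p -> is_path g -> face_at w p (g 0) ->
  unbounded_face w F0 -> F0 (g 1) -> (enclosing p <= arcs_crossed w g)%N.
Proof.
move=> cp [cg hg] g0 uF g1; apply: subset_leq_card; apply/fintype.subsetP => i.
rewrite !inE => /andP[-> neg] /=; apply/asboolP.
rewrite (face_sign i cp g0) in neg; have pos := unbounded_face_sign i uF g1.
have [|||t tI e] := @IVT R (arcfun i \o g) 0 1 0.
- exact: ler01.
(* [g'] is [g] on the subspace topology of the unit interval, where its continuity is given. *)
- move=> x; pose g' : subspace `[0, 1]%classic -> R * R := g.
  apply: (@continuous_comp _ _ _ g' (arcfun i)); first exact: cg.
  exact: arcfun_continuous.
- by rewrite /= ge_min le_max (ltW neg) (ltW pos) orbT.
- by exists t => //; apply/web_arcE; split => //; exact: hg.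
Qed.

Lemma vertical_connected (x a : R) :
  connected [set p : R * R | p.1 = x /\ a <= p.2].
Proof.
have -> : [set p : R * R | p.1 = x /\ a <= p.2] =
    (fun t : R => (x, t)) @` `[a, +oo[%classic.
  apply/seteqP; split => [[u v] /= [-> av]|_ [t /= + <-]].
    by exists v => //; rewrite in_itv /= av.
  by rewrite in_itv /= andbT.
apply: connected_continuous_connected.
  by apply/connected_intervalP; exact: interval_is_interval.
apply: continuous_subspaceT => t.
by apply: continuous_pair; [exact: cst_continuous|exact: cvg_id].
Qed.

(** The vertical ray above [p] avoids all arcs, so it lies in the face of [p]. *)
Lemma unbounded_face_far p : (2 * n)%:R < p.2 -> unbounded_face w (face_at w p).
Proof.
move=> hp.
have p0 : 0 <= p.2 by apply: ltW; apply: le_lt_trans hp.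
have sub : [set q : R * R | q.1 = p.1 /\ p.2 <= q.2] `<=` web_complement w.
  move=> q [_ pq]; apply/web_complementE; split; first exact: le_trans pq.
  by move=> i; rewrite gt_eqF// arcfun_far// (lt_le_trans hp).
have cp : web_complement w p by apply: sub.
split; first by exists p.
move=> [M [_ /(_ (`|M| + 1))]] /(_ _) H.
have /H : M < `|M| + 1 by rewrite (le_lt_trans (ler_norm M)) ?ltrDl.
have Fq : face_at w p (p.1, p.2 + `|M| + 2).
  have Bp : [set q : R * R | q.1 = p.1 /\ p.2 <= q.2] p by split.
  apply: (connected_component_max Bp sub (@vertical_connected p.1 p.2)).
  by split => //=; rewrite -addrA lerDl addr_ge0.
move=> /(_ _ Fq); apply/negP; rewrite -ltNge prod_normE lt_max; apply/orP; right => /=.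
rewrite (lt_le_trans _ (ler_norm _)) //; have := normr_ge0 M; lra.
Qed.

Lemma depth_face p : web_complement w p -> depth w (face_at w p) = enclosing p.
Proof.
move=> cp; have [p0 np] := (web_complementE p).1 cp.
(* [Y] exceeds the top of every arc, so the vertical path [g] ends in the unbounded face. *)
pose Y : R := (2 * n)%:R + 1.
have Y0 : 0 < Y by rewrite ltr_wpDl.
pose g (t : R) := (p.1, p.2 + t * Y).
have gpath : is_path g.
  split => [|t]; last by rewrite in_itv /= /half_plane /= => /andP[t0 _]; nra.
  apply: continuous_subspaceT => t.
  apply: (@continuous_pair R R R (fun=> p.1) (fun u => p.2 + u * Y)).
    exact: cst_continuous.
  by apply: cvgD; [exact: cvg_cst|apply: cvgM; [exact: cvg_id|exact: cvg_cst]].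
have uF : unbounded_face w (face_at w (g 1)).
  by apply: unbounded_face_far; rewrite /g /= mul1r /Y; lra.
have g0 : face_at w p (g 0).
  by rewrite /g mul0r addr0 -surjective_pairing; exact: connected_component_refl.
have g1 : face_at w (g 1) (g 1).
  apply: connected_component_refl; apply/web_complementE; split.
    by rewrite /g /=; lra.
  by move=> i; rewrite gt_eqF// arcfun_far// /g /= /Y; lra.
(* [arcfun i] does not decrease along [g], so an arc that [g] meets has [p] inside. *)
have crossed : arcs_crossed w g = enclosing p.
  apply/eqP; rewrite eqn_leq (arcs_crossed_ge cp gpath g0 uF g1) andbT.
  apply: subset_leq_card; apply/fintype.subsetP => i.
  rewrite !inE => /andP[-> /asboolP[t]] /=; rewrite in_itv /= => /andP[t0 _].
  move=> /web_arcE[_ e]; rewrite lt_neqAle np /= -e.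
  by apply: arcfun_le => //; nra.
(* The least crossing number is unique, so [xget] returns it and not its default value. *)
apply: xget_unique.
  split; first by exists g, (face_at w (g 1)).
  move=> m [h [F0 [hp h0 uF0 h1 <-]]]; exact: arcs_crossed_ge hp h0 uF0 h1.
move=> m [[h [F0 [hp h0 uF0 h1 <-]]] min]; apply/eqP.
rewrite eqn_leq (arcs_crossed_ge cp hp h0 uF0 h1) andbT -crossed.
by apply: min; exists g, (face_at w (g 1)).
Qed.

Lemma bandE d :
  band w d = closure [set p : R * R | web_complement w p /\ enclosing p = d].
Proof.
rewrite /band; congr closure; apply/seteqP; split=> [p [_ [[q cq ->] dq] Fp]|p [cp dp]].
  split; first exact: connected_component_sub Fp.
  by rewrite (enclosing_face cq Fp) -dq depth_face.
exists (face_at w p); last exact: connected_component_refl.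
by split; [exists p|rewrite depth_face].
Qed.

(** On the axis [arcfun i] is the product of the signed distances to the two endpoints, negative
    exactly between them. *)
Lemma gap_complement k (x : R) :
  k%:R < x < k.+1%:R -> web_complement w (x, 0) /\ enclosing (x, 0) = height w k.
Proof.
move=> /andP[kx xk].
have ltP j : (pt R j < x) = (j < k)%N.
  apply/idP/idP => [jx|jk]; last by rewrite (le_lt_trans _ kx)// /pt ler_nat.
  by have := lt_trans jx xk; rewrite /pt ltr_nat.
have gtP j : (x < pt R j) = (k <= j)%N.
  apply/idP/idP => [xj|kj]; last by rewrite (lt_le_trans xk)// /pt ler_nat.
  by have := lt_trans kx xj; rewrite /pt ltr_nat.
have nz (j : 'I_(2 * n)) : x - pt R j != 0.
  by rewrite subr_eq0 neq_lt ltP gtP; case: leqP.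
split.
  apply/web_complementE; split => //= i.
  by rewrite arcfun_axis mulf_neq0.
apply: eq_card => i; rewrite !inE arcfun_axis.
apply/idP/idP => [/andP[iw neg]|/andP[ik kw]].
  have ab : pt R i < pt R (w i) by rewrite /pt ltr_nat.
  by rewrite -ltP -gtP; apply/andP; split; rewrite ltNge; apply/negP; nra.
by rewrite (leq_trans ik kw) /= nmulr_llt0 ?subr_lt0 ?gtP// subr_gt0 ltP.
Qed.

Lemma depth_at_gap k (x : R) :
  k%:R < x < k.+1%:R -> depth_at w x = height w k.
Proof. by move=> /gap_complement[cx <-]; exact: depth_face. Qed.

(** Bands are closures, so each gap counts with both of its ends. *)
Lemma shadowP d (x : R) : (0 < d)%N ->
  shadow w d x <-> exists2 k, k%:R <= x <= k.+1%:R & (d <= height w k)%N.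
Proof.
move=> d0; split=> [[e de]|[k /andP[kx xk] dk]].
  rewrite bandE => clx.
  (* Points of [U] lie on the same side as [x] of every integer from 0 to [2n] other than [x]
     itself. *)
  pose U (p : R * R) := forall m : 'I_(2 * n).+1,
    (x < m%:R -> p.1 < m%:R) /\ (m%:R < x -> m%:R < p.1).
  have nU : \forall p \near nbhs (x, 0 : R), U p.
    apply: filter_forall => m.
    have c1 : {for (x, 0 : R), continuous (fst : R * R -> R)} by exact: cvg_fst.
    have [xm|mx|->] := ltgtP x m%:R.
    - by near=> p; split => // _; near: p; exact: c1 _ (lt_nbhsl xm).
    - by near=> p; split => // _; near: p; exact: c1 _ (lt_nbhsr mx).
    - by near=> p.
  have [p [[cp ep] Up]] := clx _ nU.
  (* As [d] is positive, some arc encloses [p]; this keeps [k], the integer part of [p.1], below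
     [2 * n], so that [U] applies to [k] and [k.+1]. *)
  have [i /andP[iw neg]] : exists i,
      [pred i : 'I_(2 * n) | (i < w i)%N && (arcfun i p < 0)] i.
    by apply/card_gt0P; rewrite -/(enclosing p) ep (leq_trans d0).
  have /andP[ip pw] := arcfun_lt0 iw neg.
  have p10 : 0 <= p.1 by rewrite (le_trans _ (ltW ip)).
  have /andP[kp pk] := truncn_itv p10.
  set k := Num.truncn p.1 in kp pk.
  have kn : (k < 2 * n)%N.
    by rewrite -(ltr_nat R) (le_lt_trans kp)// (lt_le_trans pw)// ler_nat.
  exists k.
    have [_ h1] := Up (Ordinal (leqW kn)); have [h2 _] := Up (Ordinal (leqW kn)).
    have [_ h3] := Up (Ordinal (kn : k.+1 < (2 * n).+1)%N).
    rewrite /= in h1 h2 h3.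
    apply/andP; split; rewrite leNgt; apply/negP.
      by move=> /h2; rewrite ltNge kp.
    by move=> /h3; rewrite ltNge (ltW pk).
  apply: (leq_trans de); rewrite -ep; apply: subset_leq_card.
  apply/fintype.subsetP => j; rewrite !inE => /andP[jw /(arcfun_lt0 jw)/andP[jp pj]].
  have := lt_trans jp pk; have := le_lt_trans kp pj.
  by rewrite /pt !ltr_nat !ltnS => -> ->.
exists (height w k) => //; rewrite bandE => B nB.
(* Moving slightly from [x] towards the midpoint [m] enters the open gap, even when [x] is one of
   its ends. *)
pose m : R := k%:R + 1 / 2.
have c0 : {for 0 : R, continuous (fun t : R => (x + t * (m - x), 0 : R))}.
  apply: (@continuous_pair R R R (fun t => x + t * (m - x)) (fun=> 0)).
    by apply: cvgD; [exact: cvg_cst|apply: cvgM; [exact: cvg_id|exact: cvg_cst]].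
  exact: cst_continuous.
have nB0 : nbhs (0 : R) ((fun t : R => (x + t * (m - x), 0 : R)) @^-1` B).
  by apply: c0; rewrite /= mul0r addr0.
have nBr : \forall t \near (0 : R)^'+, B (x + t * (m - x), 0).
  exact: cvg_at_right_filter cvg_id _ nB0.
have [t [Bt t0 t1]] : exists t : R, [/\ B (x + t * (m - x), 0), 0 < t & t < 1].
  near (0 : R)^'+ => t; exists t; split.
  - by near: t.
  - by near: t; exact: nbhs_right_gt.
  - by near: t; exact: nbhs_right_lt.
exists (x + t * (m - x), 0); split => //=.
apply: gap_complement.
rewrite -natr1 in xk *; rewrite /m; apply/andP; split; nra.
Unshelve. all: by end_near. Qed.

Lemma depth_near_pt i :
  \forall e \near (0 : R)^'+, depth_at w (pt R i - e) = height w i /\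
                             depth_at w (pt R i + e) = height w i.+1.
Proof.
near=> e.
have e0 : 0 < e by near: e; exact: nbhs_right_gt.
have e1 : e < 1 by near: e; exact: nbhs_right_lt.
by split; apply: depth_at_gap; rewrite /pt -!natr1; apply/andP; split; lra.
Unshelve. all: by end_near. Qed.

Lemma is_plusE i : is_plus R w i = (height w i < height w i.+1)%N.
Proof.
apply/asboolP/idP => [H|lt].
  near (0 : R)^'+ => e.
  have [<- <-] : depth_at w (pt R i - e) = height w i /\
      depth_at w (pt R i + e) = height w i.+1 by near: e; exact: depth_near_pt.
  by near: e.
by apply: filterS (depth_near_pt i) => e [-> ->].
Unshelve. all: by end_near. Qed.

Lemma is_minusE i : is_minus R w i = (height w i.+1 < height w i)%N.
Proof.
apply/asboolP/idP => [H|lt].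
  near (0 : R)^'+ => e.
  have [<- <-] : depth_at w (pt R i - e) = height w i /\
      depth_at w (pt R i + e) = height w i.+1 by near: e; exact: depth_near_pt.
  by near: e.
by apply: filterS (depth_near_pt i) => e [-> ->].
Unshelve. all: by end_near. Qed.

End Faces.

Lemma prec_S_height (R : realType) n (w w' : web n) :
  prec_S R w w' <-> w <> w' /\ forall k, (height w k <= height w' k)%N.
Proof.
split=> -[ne H]; split => //.
  move=> k; case: (posnP (height w k)) => [->//|h0].
  (* The midpoint of gap [k] belongs to no other closed gap, so the shadow of level [height w k],
     tested there, compares the heights over that gap alone. *)
  have mid : k%:R <= (k%:R + 1 / 2 : R) <= k.+1%:R.
    by rewrite -(@natr1 R k); apply/andP; split; lra.
  have mid_w : shadow w (height w k) (k%:R + 1 / 2 : R).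
    by apply/shadowP => //; exists k.
  have /(shadowP w' _ h0)[k' /andP[k'k kk'] hk'] := H _ h0 _ mid_w.
  suff kE : k' = k by rewrite kE in hk'.
  rewrite -(natr1 k') in kk'; apply/eqP; rewrite eqn_leq.
  rewrite -ltnS -[(k <= k')%N]ltnS -!(ltr_nat R) -(natr1 k) -(natr1 k').
  by apply/andP; split; lra.
move=> d d0 x /(shadowP w _ d0)[k kx dk]; apply/shadowP => //.
by exists k => //; apply: leq_trans (H k).
Qed.

Local Open Scope nat_scope.

(** * Heights and the matching *)

Section Heights.
Variables (n : nat) (w : web n).
Implicit Types i j : 'I_(2 * n).

Lemma partner_neq i : w i != i.
Proof. by case: w => m /= /andP[/forallP/(_ i)/andP[]]. Qed.

Lemma partnerK : involutive w.
Proof. by move=> i; case: w => m /= /andP[/forallP/(_ i)/andP[_ /eqP]]. Qed.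

Lemma noncrossing i j : i < j -> j < w i -> w j <= w i.
Proof.
case: w => m /= /andP[_ /forallP/(_ i)/forallP/(_ j)] nc ij ji.
by move: nc; rewrite ij ji /= -leqNgt.
Qed.

Lemma height0 : height w 0 = 0.
Proof. by apply: eq_card0 => j; rewrite !inE. Qed.

Lemma height_ge k : 2 * n <= k -> height w k = 0.
Proof.
move=> nk; apply: eq_card0 => j; rewrite !inE.
by have := ltn_ord (w j); lia.
Qed.

Lemma height_open i : i < w i -> height w i.+1 = (height w i).+1.
Proof.
move=> iw; rewrite /height (cardD1 i) !inE ltnSn iw; congr _.+1.
apply: eq_card => j; rewrite !inE -val_eqE /=.
have [->|ji] := eqVneq j i; first by rewrite eqxx ltnn.
have wji : (w j != i :> nat) || (i < j).
  case: eqVneq => //= e; have : w j = i by apply: val_inj.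
  by move=> wj; rewrite -wj partnerK wj in iw.
by move: ji; rewrite -val_eqE /=; lia.
Qed.

Lemma height_close i : w i < i -> height w i = (height w i.+1).+1.
Proof.
move=> wi; rewrite /height (cardD1 (w i)) !inE wi partnerK leqnn; congr _.+1.
apply: eq_card => j; rewrite !inE.
have [->|jw] := eqVneq j (w i); first by rewrite partnerK ltnn !andbF.
have wji : w j != i by apply: contra_neq jw => <-; rewrite partnerK.
have [->|ji] := eqVneq j i; first by rewrite ltnn /=; lia.
by move: ji wji; rewrite -!val_eqE /=; lia.
Qed.

Lemma height_lt_open i : (height w i < height w i.+1) = (i < w i).
Proof.
case: (ltngtP i (w i)) => [/height_open->|/height_close->|e].
- by rewrite ltnSn.
- by rewrite ltnNge leqnSn.
- by have := partner_neq i; rewrite -val_eqE /= -e eqxx.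
Qed.

Lemma height_lt_close i : (height w i.+1 < height w i) = ~~ (i < w i).
Proof.
case: (ltngtP i (w i)) => [/height_open->|/height_close->|e].
- by rewrite ltnNge leqnSn.
- by rewrite ltnSn.
- by have := partner_neq i; rewrite -val_eqE /= -e eqxx.
Qed.

(** An arc over the gap left of [i] cannot end under the arc of [i], so it still passes over gap
    [k], where the arc of [i] is added. *)
Lemma height_under i k : i < k <= w i -> height w i < height w k.
Proof.
move=> ik; rewrite /height [X in _ < X](cardD1 i) !inE ik add1n ltnS.
apply: subset_leq_card; apply/fintype.subsetP => j; rewrite !inE => /andP[ji iwj].
have wji : w j != i.
  by apply/eqP => wj; move: ik ji; rewrite -wj partnerK; lia.
have iwj' : i < w j by rewrite ltn_neqAle eq_sym wji.
have jwi := noncrossing ji iwj'.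
by rewrite -val_eqE /=; lia.
Qed.

(** An arc over the gap right of [w i] cannot start under the arc of [i], so it starts before
    [i]. *)
Lemma height_after i : i < w i -> height w (w i).+1 <= height w i.
Proof.
move=> iw; apply: subset_leq_card; apply/fintype.subsetP => j.
rewrite !inE => /andP[jwi wj].
have jw : j != w i by apply/eqP => e; move: wj iw; rewrite e partnerK; lia.
have ji : j != i by apply/eqP => e; move: wj; rewrite e ltnn.
have := @noncrossing i j.
by move: jw ji; rewrite -!val_eqE /=; lia.
Qed.

End Heights.

Lemma height_inj n (w w' : web n) : height w =1 height w' -> w = w'.
Proof.
move=> hh.
have same (i : 'I_(2 * n)) : (i < w i) = (i < w' i) by rewrite -!height_lt_open !hh.
have le (v v' : web n) (i : 'I_(2 * n)) : height v =1 height v' ->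
    i < v i -> i < v' i -> v' i <= v i.
  (* Were [v i] before [v' i], the gap right of [v i] would be higher than gap [i] for [v'] but not
     for [v]. *)
  move=> hv iv iv'; rewrite leqNgt; apply/negP => lt.
  have := height_after iv; rewrite leqNgt !hv height_under //.
  by rewrite lt ltnS ltnW.
have eq_open (i : 'I_(2 * n)) : i < w i -> w i = w' i.
  move=> iw; apply: val_inj; apply/eqP; rewrite eqn_leq.
  by rewrite !le // -?same // => k; rewrite hh.
apply: val_inj; apply/ffunP => i /=.
case: (ltngtP i (w i)) => [/eq_open //|wi|e].
  have /eq_open : w i < w (w i) by rewrite partnerK.
  by rewrite partnerK => {2}->; rewrite partnerK.
by have := partner_neq w i; rewrite -val_eqE /= -e eqxx.
Qed.

(** * Words in [+] and [-] and their two-row fillings *)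

Definition pluses (P : pred nat) (k : nat) : nat := count P (iota 1 k).

Definition fill (N : nat) (P : pred nat) : filling :=
  [:: [seq x <- iota 1 N | P x]; [seq x <- iota 1 N | ~~ P x]].

(** The words of Dyck paths, [P x] meaning that symbol [x] is [+]; doubling avoids counting the [-]
    separately. *)
Definition ballot (N : nat) (P : pred nat) : Prop :=
  (forall k, k <= N -> k <= (pluses P k).*2) /\ (pluses P N).*2 = N.

Lemma plusesS P k : pluses P k.+1 = pluses P k + P k.+1.
Proof. by rewrite /pluses -[k.+1]addn1 iotaD count_cat /= addn0 add1n addn1. Qed.

Lemma count_le_filter_iota N P k : k <= N ->
  count (leq^~ k) [seq x <- iota 1 N | P x] = pluses P k.
Proof.
move=> kN; rewrite count_filter -(subnKC kN) iotaD count_cat.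
rewrite [X in _ + X](_ : _ = 0) ?addn0.
  by apply: eq_in_count => x; rewrite mem_iota /=; lia.
apply/eqP; rewrite -leqn0 leqNgt -has_count; apply/hasPn => x.
by rewrite mem_iota /=; lia.
Qed.

(** If [y] stands in column [c] of the bottom row, then [c] symbols [-] precede it; by the ballot
    condition at [y] more than [c] symbols [+] do, so the entry above is smaller. *)
Lemma fill_standard N P : 0 < N -> ballot N P -> is_standard (fill N P).
Proof.
move=> N0 [bal tot].
have sizeP : size [seq x <- iota 1 N | P x] = pluses P N by rewrite size_filter.
have sizeQ : size [seq x <- iota 1 N | ~~ P x] = pluses P N.
  rewrite size_filter; apply: (@addnI (pluses P N)).
  by rewrite addnn tot [LHS]count_predC size_iota.
apply/and5P; split.
- by rewrite /= sizeP sizeQ leqnn.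
- by rewrite /shape /= sizeP sizeQ !inE; lia.
- rewrite /= cats0 size_cat sizeP sizeQ addnn tot.
  by apply/permPl/perm_filterC.
- by rewrite /= !sorted_filter ?iota_ltn_sorted //; exact: ltn_trans.
- apply/forallP => -[[|r] //= _]; apply/forallP => -[c /= cs].
  set y := nth 0 [seq x <- iota 1 N | ~~ P x] c.
  have : y \in [seq x <- iota 1 N | ~~ P x] by exact: mem_nth.
  rewrite mem_filter mem_iota => /andP[Py /andP[y1 yN]].
  have lts : sorted ltn [seq x <- iota 1 N | ~~ P x].
    by rewrite sorted_filter ?iota_ltn_sorted //; exact: ltn_trans.
  have countlt Q : count (fun x => x < y) [seq x <- iota 1 N | Q x] = pluses Q y.-1.
    rewrite -(count_le_filter_iota (N := N)); last by lia.
    by apply: eq_count => x; lia.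
  have cy : pluses (predC P) y.-1 = c.
    by rewrite -countlt; apply: (@count_lt_nth _ _ 0).
  have := bal y; rewrite -(prednK (_ : 0 < y)) // plusesS prednK // (negbTE Py) addn0.
  have := count_predC P (iota 1 y.-1).
  rewrite size_iota -/(pluses P _) -/(pluses (predC P) _) cy => sum.
  move=> baly; apply: (@nth_count_lt _ _ y).
    by rewrite sorted_filter ?iota_sorted //; exact: leq_trans.
  by rewrite [count _ _]countlt; lia.
Qed.

(* Turns a valley [-+] at the positions [i], [i.+1] into a peak [+-]. *)
Definition raise (P : pred nat) (i : nat) : pred nat :=
  [eta P with i |-> true, i.+1 |-> false].

Lemma pluses_raise (P : pred nat) i k : 0 < i -> ~~ P i -> P i.+1 ->
  pluses (raise P i) k = pluses P k + (k == i).
Proof.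
move=> i0 Pi PSi; elim: k => [|k IH]; first by rewrite eq_sym; move: i0; case: (i).
rewrite !plusesS IH /raise /= !eqSS.
have [->|_] := eqVneq k i.
  by rewrite PSi (gtn_eqF (ltnSn i)) !addn0.
have [->|_] := eqVneq k.+1 i; last by rewrite !addn0.
by rewrite (negbTE Pi) /=; lia.
Qed.

(** Rows stay increasing under the swap, since [i] and [i.+1] are consecutive and lie in different
    rows. *)
Lemma fill_raise N (P : pred nat) i : 0 < i -> i < N -> ~~ P i -> P i.+1 ->
  fill N (raise P i) = swap_entries i (fill N P).
Proof.
move=> i0 iN Pi PSi.
have iotaE : iota 1 N = iota 1 i.-1 ++ [:: i; i.+1] ++ iota i.+2 (N - i.+1).
  have {1}-> : N = i.-1 + (2 + (N - i.+1)) by lia.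
  by rewrite iotaD (_ : 1 + i.-1 = i) ?iotaD ?addn2 //; lia.
pose sw := [eta id with i |-> i.+1, i.+1 |-> i].
have keep (Q Q' : pred nat) l : {in l, forall x, (x != i) && (x != i.+1)} ->
    (forall x, x != i -> x != i.+1 -> Q x = Q' x) ->
    map sw (seq.filter Q l) = seq.filter Q' l.
  move=> out QQ'; rewrite map_id_in.
    by apply: eq_in_filter => x /out/andP[]; exact: QQ'.
  move=> x; rewrite mem_filter => /andP[_ /out/andP[/negbTE xi /negbTE xS]] /=.
  by rewrite xi xS.
have eqP x : x != i -> x != i.+1 -> P x = raise P i x.
  by move=> /negbTE xi /negbTE xS; rewrite /raise /= xi xS.
have out1 : {in iota 1 i.-1, forall x, (x != i) && (x != i.+1)}.
  by move=> x; rewrite mem_iota; lia.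
have out2 : {in iota i.+2 (N - i.+1), forall x, (x != i) && (x != i.+1)}.
  by move=> x; rewrite mem_iota; lia.
have row (Q Q' : pred nat) : (forall x, x != i -> x != i.+1 -> Q x = Q' x) ->
    map sw (seq.filter Q [:: i; i.+1]) = seq.filter Q' [:: i; i.+1] ->
    map sw (seq.filter Q (iota 1 N)) = seq.filter Q' (iota 1 N).
  move=> QQ' mid; rewrite iotaE [seq.filter Q _]filter_cat.
  rewrite [seq.filter Q (_ ++ _)]filter_cat.
  rewrite [RHS]filter_cat [X in _ = _ ++ X]filter_cat !map_cat mid.
  by rewrite (keep Q Q') // (keep Q Q').
have SiE : (i.+1 == i) = false by rewrite gtn_eqF.
rewrite /swap_entries /=; congr [:: _; _]; apply/esym/row.
- exact: eqP.
- by rewrite /= /raise (negbTE Pi) PSi /= eqxx SiE eqxx.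
- by move=> x xi xS; rewrite (eqP x).
- by rewrite /= /raise (negbTE Pi) PSi /= !eqxx SiE.
Qed.

Lemma ballot_raise N (P : pred nat) i : 0 < i -> i < N -> ~~ P i -> P i.+1 ->
  ballot N P -> ballot N (raise P i).
Proof.
move=> i0 iN Pi PSi [bal tot]; split; last by rewrite pluses_raise // gtn_eqF // addn0.
by move=> k kN; rewrite pluses_raise // doubleD (leq_trans (bal k kN)) // leq_addr.
Qed.

Lemma arrow_raise N (P : pred nat) i : 0 < i -> i < N -> ~~ P i -> P i.+1 ->
  ballot N P -> tab_arrow i (fill N P) (fill N (raise P i)).
Proof.
move=> i0 iN Pi PSi bal; have N0 : 0 < N by exact: leq_trans iN.
have eqF := fill_raise i0 iN Pi PSi.
split => //.
- exact: fill_standard.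
- by apply: fill_standard => //; exact: ballot_raise.
- rewrite eqF /swap_entries /shape -map_comp; apply: eq_map => r /=.
  by rewrite size_map.
- rewrite /row_of /fill /= !mem_filter /= !mem_iota /raise /= !eqxx (gtn_eqF (ltnSn i)).
  by rewrite i0 add1n !ltnS iN (ltnW iN).
Qed.

(** * Chains of arrows from dominance of words *)

Lemma valley N (P P' : pred nat) k :
  (pluses P N).*2 = N -> (pluses P' N).*2 = N ->
  (forall k, k <= N -> pluses P k <= pluses P' k) ->
  k <= N -> pluses P k < pluses P' k ->
  exists i, [/\ 0 < i, i < N, ~~ P i, P i.+1 & pluses P i < pluses P' i].
Proof.
move=> tot tot' le kN ltk.
have [m /andP[mN ltm] minm] :=
  @ex_minnP (fun m => (m <= N) && (pluses P m < pluses P' m))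
    (ex_intro _ k (introT andP (conj kN ltk))).
have m0 : 0 < m by case: m ltm {mN minm}.
(* A [+] at the first strict place [m] would make [m.-1] strict already. *)
have Pm : ~~ P m.
  apply/negP => Pm; have := minm m.-1; have := ltm.
  rewrite -{1 2}(prednK m0) !plusesS prednK // Pm.
  by have := leq_b1 (P' m); lia.
(* Without such a valley [P] has only [-] from [m] on, so the inequality stays strict up to [N],
   against the equal totals. *)
apply: contrapT => none.
have run j : m + j <= N -> ~~ P (m + j) && (pluses P (m + j) < pluses P' (m + j)).
  elim: j => [|j IH] mjN; first by rewrite addn0 Pm.
  have /IH/andP[Pmj ltmj] : m + j <= N by lia.
  have Pn : ~~ P (m + j.+1).
    by apply/negP => PS; apply: none; exists (m + j); rewrite -addnS; split=> //; lia.
  by rewrite Pn addnS !plusesS; move: Pn; rewrite addnS => /negbTE ->; lia.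
have := run (N - m); rewrite subnKC // => /(_ (leqnn _))/andP[_].
by lia.
Qed.

Lemma fill_eq N (P P' : pred nat) :
  (forall k, k <= N -> pluses P k = pluses P' k) -> fill N P = fill N P'.
Proof.
move=> eqN.
have e : {in iota 1 N, P =1 P'}.
  move=> x; rewrite mem_iota => /andP[x0 xN].
  have := plusesS P x.-1; have := plusesS P' x.-1; rewrite prednK // !eqN; lia.
by rewrite /fill (eq_in_filter e); congr [:: _; _]; apply: eq_in_filter => x /e->.
Qed.

Lemma dominance_chain N (P P' : pred nat) : 0 < N -> ballot N P -> ballot N P' ->
  (forall k, k <= N -> pluses P k <= pluses P' k) ->
  (exists2 k, k <= N & pluses P k < pluses P' k) ->
  tab_lt (fill N P) (fill N P').
Proof.
(* Induction on the total deficit, which each raised valley lowers by one. *)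
move=> N0; have [d] := ubnP (\sum_(k < N.+1) (pluses P' k - pluses P k)).
elim: d P => // d IH P ltd balP balP' le [k kN ltk].
have [i [i0 iN Pi PSi lti]] := valley balP.2 balP'.2 le kN ltk.
have arrow : tab_lt (fill N P) (fill N (raise P i)).
  by apply: t_step; exists i; exact: arrow_raise.
have leR j : j <= N -> pluses (raise P i) j <= pluses P' j.
  move=> jN; rewrite pluses_raise //.
  by case: eqVneq => [->|_]; rewrite ?addn1 ?addn0 ?le.
have balR : ballot N (raise P i) by exact: ballot_raise.
(* A chain needs at least one arrow, so the induction hypothesis serves only while some prefix count
   is still smaller; otherwise this arrow is the last. *)
case: (boolP [exists j : 'I_N.+1, pluses (raise P i) j < pluses P' j])
  => [/existsP[j ltj]|].
  apply: t_trans arrow _; apply: IH => //; last by exists j => //; rewrite -ltnS.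
  apply: leq_trans _ (ltd : _ <= d).
  have iE : (inord i : 'I_N.+1) = i :> nat by rewrite inordK // ltnS ltnW.
  rewrite (bigD1 (inord i)) //= [X in _ < X](bigD1 (inord i)) //= iE.
  rewrite pluses_raise // eqxx -addSn; apply: leq_add; first by lia.
  by apply: leq_sum => l _; rewrite pluses_raise // leq_sub2l // leq_addr.
rewrite negb_exists => /forallP none.
suff <- : fill N (raise P i) = fill N P' by [].
apply: fill_eq => j jN.
apply/eqP; rewrite eqn_leq leR //= leqNgt.
by have := none (inord j); rewrite inordK.
Qed.

(** * Boundary words of webs, and the effect of arrows on prefix counts *)

Definition opens n (w : web n) : pred nat := fun x => height w x.-1 < height w x.

(** The height is the excess of [+] over [-] among the first [k] symbols. *)
Lemma pluses_opens n (w : web n) k : k <= 2 * n ->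
  (pluses (opens w) k).*2 = k + height w k.
Proof.
elim: k => [|k IH] kn; first by rewrite height0.
rewrite plusesS doubleD IH ?(ltnW kn) //.
pose i := Ordinal kn; rewrite /opens -[k.+1.-1]/(val i) -[k.+1]/((val i).+1).
rewrite -[height w k]/(height w (val i)) height_lt_open.
case: (ltngtP i (w i)) => [/height_open e|/height_close e|e].
- by rewrite e /=; lia.
- by rewrite e /=; lia.
- by have := partner_neq w i; rewrite -val_eqE /= -e eqxx.
Qed.

Lemma ballot_opens n (w : web n) : ballot (2 * n) (opens w).
Proof.
split=> [k kn|]; first by rewrite pluses_opens // leq_addr.
by rewrite pluses_opens // height_ge // addn0.
Qed.

(** The arrow replaces [i.+1] by [i] in the top row, which raises only the count of entries at most
    [i]. *)
Lemma arrow_dominance i T T' : size T = 2 -> tab_arrow i T T' ->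
  [/\ size T' = 2,
      forall k, count (leq^~ k) (nth [::] T 0) <= count (leq^~ k) (nth [::] T' 0) &
      exists k, count (leq^~ k) (nth [::] T 0) < count (leq^~ k) (nth [::] T' 0)].
Proof.
case: T => [|a [|b [|]]] // _ [std std' _ T'E rows]; rewrite T'E in std' rows *.
pose sw := [eta id with i |-> i.+1, i.+1 |-> i].
have swK : involutive sw.
  move=> x; rewrite /sw /=; have [->|xi] := eqVneq x i.
    by rewrite (gtn_eqF (ltnSn i)) eqxx.
  have [->|xS] := eqVneq x i.+1; first by rewrite eqxx.
  by rewrite (negbTE xi) (negbTE xS).
have swi : sw i = i.+1 by rewrite /sw /= eqxx.
have swS : sw i.+1 = i by rewrite -swi swK.
have mem_sw x s : (x \in map sw s) = (sw x \in s).
  by rewrite -{1}[x]swK (mem_map (can_inj swK)).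
have entries (T : filling) : is_standard T -> flatten T =i iota 1 (size (flatten T)).
  by case/and5P => _ _ /perm_mem.
(* [row_of] gives 2 to an absent entry, so [i] in the bottom row of the new filling with [i.+1]
   absent must be excluded too: the entries of both fillings form an initial segment starting at
   1. *)
have [aS ai] : i.+1 \in a /\ i \notin a.
  move: rows; rewrite /row_of /= !mem_sw swi swS.
  case: (boolP (i.+1 \in a)); case: (boolP (i \in a)) => // ia aS.
  case: (boolP (i.+1 \in b)); case: (boolP (i \in b)) => // ib bS _.
  have := entries _ std i; have := entries _ std i.+1; have := entries _ std' i.+1.
  have := entries _ std' i.
  rewrite /= !cats0 !size_cat !size_map !mem_cat !mem_sw swi swS bS.
  rewrite (negbTE ia) (negbTE ib) orbT !mem_iota.
  by lia.
have sw_le x k : x \in a -> x <= k -> sw x <= k.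
  rewrite /sw /=; have [->|_] := eqVneq x i; first by rewrite (negbTE ai).
  by have [->|_] := eqVneq x i.+1; last by []; move=> _ /ltnW.
have grow (A B : pred nat) : {in a, forall x, A x -> B x} -> count A a <= count B a.
  move=> AB; rewrite (@eq_in_count _ A (predI A B)); last first.
    by move=> x xa /=; case: (boolP (A x)) => //= /(AB _ xa)->.
  by apply: sub_count => x /andP[].
split=> // [k|]; first by rewrite /= count_map; apply: grow => x xa /=; exact: sw_le.
exists i; rewrite /= count_map.
(* The swap makes at most [i] all top entries that were so, and [i.+1] in addition. *)
have : count (predU (leq^~ i) (pred1 i.+1)) a <= count (preim sw (leq^~ i)) a.
  apply: grow => x xa /= /orP[|/eqP->]; first exact: sw_le.
  by change (sw i.+1 <= i); rewrite swS.
apply: leq_trans; rewrite -(@leq_add2r (count (predI (leq^~ i) (pred1 i.+1)) a)).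
rewrite count_predUI (@eq_count _ (predI _ _) pred0) ?count_pred0 ?addn0; last first.
  by move=> x /=; case: eqVneq => [->|]; rewrite ?ltnn ?andbF.
by rewrite -addn1 leq_add2l -has_count has_pred1.
Qed.

Lemma chain_dominance T T' : tab_lt T T' -> size T = 2 ->
  [/\ size T' = 2,
      forall k, count (leq^~ k) (nth [::] T 0) <= count (leq^~ k) (nth [::] T' 0) &
      exists k, count (leq^~ k) (nth [::] T 0) < count (leq^~ k) (nth [::] T' 0)].
Proof.
elim=> {T T'} [T T' [i arrow] sT|T1 T2 T3 _ IH12 _ IH23 s1].
  exact: arrow_dominance arrow.
have [s2 le12 [k lt12]] := IH12 s1; have [s3 le23 _] := IH23 s2.
split=> // [l|]; first exact: leq_trans (le12 l) (le23 l).
by exists k; exact: leq_trans lt12 (le23 k).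
Qed.

Lemma psi_fill (R : realType) n (w : web n) :
  psi R w = fill (2 * n) (opens w).
Proof.
have rowE (p : pred 'I_(2 * n)) (P : pred nat) : p =1 (fun i => P i.+1) ->
    [seq i.+1 | i : 'I_(2 * n) <- enum 'I_(2 * n) & p i] =
    [seq x <- iota 1 (2 * n) | P x].
  move=> pP; rewrite (iotaDl 1 0) -val_enum_ord -map_comp filter_map.
  by rewrite (eq_filter pP).
rewrite /psi /fill; congr [:: _; _]; apply: rowE => i.
  exact: is_plusE.
(* Every boundary point changes the height, so a symbol that is not [+] is [-]. *)
by rewrite is_minusE /opens /= height_lt_open height_lt_close.
Qed.

Lemma pluses_height n (w w' : web n) k : k <= 2 * n ->
  (pluses (opens w) k <= pluses (opens w') k) = (height w k <= height w' k).
Proof. by move=> kn; rewrite -leq_double !pluses_opens // leq_add2l. Qed.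

Local Close Scope nat_scope.

Theorem theorem5p9 (R : realType) (n : nat) (hn : (1 <= n)%N) (w w' : web n) :
  prec_S R w w' <-> prec_T R w w'.
Proof.
rewrite prec_S_height /prec_T !psi_fill.
split=> [[ne le]|/chain_dominance[] // _ le [k lt]].
  apply: dominance_chain; [by rewrite muln_gt0|exact: ballot_opens..| |].
    by move=> k kn; rewrite pluses_height.
  (* Distinct webs differ in height somewhere, and heights vanish beyond [2 * n], so a strict place
     lies within range. *)
  apply: contrapT => none; apply: ne; apply: height_inj => k.
  apply/eqP; rewrite eqn_leq le /= leqNgt; apply/negP => lt; apply: none.
  have kn : (k <= 2 * n)%N.
    by rewrite leqNgt; apply/negP => kn; rewrite !height_ge ?ltnn // ltnW in lt.
  by exists k => //; rewrite ltnNge pluses_height // -ltnNge.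
split=> [e|j]; first by rewrite e ltnn in lt.
have [jn|nj] := leqP j (2 * n); last by rewrite height_ge // ltnW.
by have := le j; rewrite !count_le_filter_iota // pluses_height.
Qed.
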